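(* Fix an isometric action $G\curvearrowright X$ of a countable group $G$ on a separable hyperbolic metric space $X$. Let $(G,\Gamma)$ be an almost semisimple graph structure, and let $H<G$ be a nonelementary subgroup. If $(G,\Gamma)$ is thick relative to $H$, then it is nonelementary, i.e. for any vertex $v$ of maximal growth the action of the loop semigroup $\Gamma_v$ on $X$ is nonelementary.
   Context: Graph structures: a graph structure $(G,\Gamma)$ consists of a countable group $G$ and a finite directed graph $\Gamma$ such that (a) $\Gamma$ has an initial vertex $v_0$ from which every other vertex can be reached by a directed path; (b) every edge is labeled by an element of $G$, and distinct edges directed out of a fixed vertex have distinct labels. The evaluation map $\mathrm{ev}$ sends a finite path to the product of its edge labels. $S_n$ is the set of paths of length $n$ starting at $v_0$. The structure is almost semisimple (of growth $\lambda$) if there are $c>0$, $\lambda>1$ with $c^{-1}\lambda^n\le\#S_n\le c\lambda^n$ for all $n$. Irreducible components of $\Gamma$ are the classes of mutually accessible vertices. A component $C$ is maximal if for some (equivalently any) $v\in C$ the number $a_n$ of paths of length $n$ starting at $v$ and contained in $C$ satisfies $\limsup_n\sqrt[n]{a_n}=\lambda$; a vertex is maximal, or has maximal growth, if it lies in a maximal component. The loop semigroup $\Gamma_v\subseteq G$ is the set of evaluations of closed directed paths based at $v$. The structure is thick relative to a subgroup $H<G$ if for every vertex $v$ of maximal growth there is a finite set $B\subseteq G$ with $H\subseteq B\,\Gamma_v\,B$. Hyperbolic spaces: a hyperbolic space is a geodesic metric space $X$ for which there is $\delta\ge0$ such that each side of every geodesic triangle lies in the $\delta$-neighborhood of the other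 two sides; $\partial X$ is its Gromov boundary. An isometry $g$ is loxodromic if $\lim_{n\to\infty}d(g^nx,x)/n>0$; two loxodromics are independent if their fixed point sets on $\partial X$ are disjoint. A group or semigroup acting on $X$ is nonelementary if it contains two independent loxodromics. *)

(* Defs.v *)
From HB Require Import structures.
From mathcomp Require Import all_boot all_order all_algebra.
From mathcomp Require Import all_classical all_reals all_analysis.

Set Implicit Arguments.
Unset Strict Implicit.
Unset Printing Implicit Defensive.

Import Order.TTheory GRing.Theory Num.Theory.
Import numFieldNormedType.Exports.

Local Open Scope classical_set_scope.
Local Open Scope ring_scope.

Definition edge_rel (V E : finType) (src tgt : E -> V) : rel V :=
  [rel x y | [exists e, (src e == x) && (tgt e == y)]].

(* Parallel edges and self-loops are allowed, so edges form a type of their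
   own rather than a relation on the vertices. *)
Record graph_structure (G : groupType) := GraphStructure {
  gvertex : finType;
  gedge : finType;
  gsrc : gedge -> gvertex;
  gtgt : gedge -> gvertex;
  glabel : gedge -> G;
  ginit : gvertex;
  ginit_reach : forall v : gvertex,
    connect (edge_rel gsrc gtgt) ginit v;
  glabel_inj : forall e f : gedge,
    gsrc e = gsrc f -> glabel e = glabel f -> e = f
}.

Section GraphStructure.
Context {G : groupType} (Gam : graph_structure G).
Local Notation V := (gvertex Gam).
Local Notation E := (gedge Gam).

Definition gadj : rel V :=
  edge_rel (@gsrc _ Gam) (@gtgt _ Gam).

(* Directed paths are sequences of edges; the empty sequence is the path of
   length 0 at [v]. *)
Fixpoint path_from (v : V) (p : seq E) : bool :=
  if p is e :: p' then (gsrc e == v) && path_from (gtgt e) p' else true.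

Definition path_end (v : V) (p : seq E) : V := last v (map (@gtgt _ Gam) p).

Definition path_vertices (v : V) (p : seq E) : seq V :=
  v :: map (@gtgt _ Gam) p.

(* Labels are multiplied in the order in which the path traverses them. *)
Definition path_ev (p : seq E) : G := (\prod_(e <- p) glabel e)%g.

Definition sphere (n : nat) : {set n.-tuple E} :=
  [set p : n.-tuple E | path_from (ginit Gam) p].

Definition almost_semisimple {R : realType} (lam : R) : Prop :=
  1 < lam /\ exists2 c : R, 0 < c &
    forall n : nat,
      c^-1 * lam ^+ n <= #|sphere n|%:R /\ #|sphere n|%:R <= c * lam ^+ n.

Definition irreducible_components : {set {set V}} :=
  equivalence_partition
    [rel x y | connect gadj x y && connect gadj y x] [set: V].

Definition paths_in (C : {set V}) (v : V) (n : nat) : {set n.-tuple E} :=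
  [set p : n.-tuple E | path_from v p && all (mem C) (path_vertices v p)].

Definition maximal_component {R : realType} (lam : R) (C : {set V}) : Prop :=
  C \in irreducible_components /\
  exists2 v : V, v \in C &
    limn_esup (fun n => ((#|paths_in C v n|%:R : R) `^ n%:R^-1)%:E) = lam%:E.

Definition maximal_vertex {R : realType} (lam : R) (v : V) : Prop :=
  exists2 C : {set V}, maximal_component lam C & v \in C.

Definition loop_semigroup (v : V) : set G :=
  [set g | exists p : seq E, [/\ path_from v p, path_end v p = v &
                                 g = path_ev p]].

Definition thick_relative {R : realType} (lam : R) (H : set G) : Prop :=
  forall v : V, maximal_vertex lam v ->
    exists2 B : set G, finite_set B &
      H `<=` [set h | exists b1 g b2, [/\ B b1, loop_semigroup v g, B b2 &
                                          h = (b1 * g * b2)%g]].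

End GraphStructure.

Definition subgroup {G : groupType} (H : set G) : Prop :=
  [/\ H 1%g, (forall x y, H x -> H y -> H (x * y)%g) &
      (forall x, H x -> H (x^-1)%g)].

Section Hyperbolic.
Context {R : realType} (X : metricType R).

Definition geodesic_segment (x y : X) (S : set X) : Prop :=
  exists gam : R -> X,
    [/\ gam 0 = x, gam (mdist x y) = y,
        {in `[0, mdist x y] &, forall s t, mdist (gam s) (gam t) = `|s - t|} &
        S = gam @` `[0, mdist x y]].

Definition geodesic_space : Prop :=
  forall x y : X, exists S, geodesic_segment x y S.

Definition neighborhood (delta : R) (S : set X) : set X :=
  [set p | exists2 q, S q & mdist p q <= delta].

Definition hyperbolic_space : Prop :=
  geodesic_space /\
  exists2 delta : R, 0 <= delta &
    forall (x y z : X) (A B C : set X),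
      geodesic_segment x y A -> geodesic_segment y z B ->
      geodesic_segment z x C ->
      [/\ A `<=` neighborhood delta (B `|` C),
          B `<=` neighborhood delta (A `|` C) &
          C `<=` neighborhood delta (A `|` B)].

Definition separable_space : Prop :=
  exists2 D : set X, countable D & dense D.

Definition gromov_product (o x y : X) : R :=
  (mdist x o + mdist y o - mdist x y) / 2.

(* [liminf_(i, j -> oo) (u_i | v_j)_o = +oo]; in any metric space this does not
   depend on the base point [o]. *)
Definition gromov_asymptotic (u v : nat -> X) : Prop :=
  forall o : X,
    gromov_product o (u ij.1) (v ij.2) @[ij --> (\oo, \oo)] --> +oo.

Definition gromov_sequence (u : nat -> X) : Prop := gromov_asymptotic u u.

(* [X] need not be proper, so points of the Gromov boundary are equivalence
   classes of sequences converging to infinity (not of geodesic rays), each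
   class being represented as a set of sequences. *)
Definition gromov_boundary : set (set (nat -> X)) :=
  [set xi | exists2 u, gromov_sequence u &
     xi = [set v | gromov_sequence v /\ gromov_asymptotic u v]].

End Hyperbolic.

Section Action.
Context {R : realType} {G : groupType} {X : metricType R}.

Definition isometric_action (act : G -> X -> X) : Prop :=
  [/\ (forall x, act 1%g x = x),
      (forall g h x, act (g * h)%g x = act g (act h x)) &
      (forall g x y, mdist (act g x) (act g y) = mdist x y)].

Context (act : G -> X -> X).

(* The limit exists and does not depend on [x] when [act] is isometric. *)
Definition loxodromic (g : G) : Prop :=
  exists x : X, exists2 l : R, 0 < l &
    mdist (act (g ^+ n)%g x) x / n%:R @[n --> \oo] --> l.

Definition boundary_act (g : G) (xi : set (nat -> X)) : set (nat -> X) :=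
  [set act g \o u | u in xi].

Definition boundary_fixed_points (g : G) : set (set (nat -> X)) :=
  [set xi | gromov_boundary xi /\ boundary_act g xi = xi].

Definition independent (g h : G) : Prop :=
  boundary_fixed_points g `&` boundary_fixed_points h = set0.

Definition nonelementary (S : set G) : Prop :=
  exists g h : G, [/\ S g, S h, loxodromic g, loxodromic h & independent g h].

End Action.

(* Main.v *)
Require Import Defs.
From mathcomp Require Import all_boot all_order all_algebra.
From mathcomp Require Import all_classical all_reals all_analysis.
From mathcomp Require Import lra.

(** Write [P g h] for the Gromov product [(g o | h o)_o] of two orbit points and
    [N g] for the distance from [g o] to [o].

    The argument works with the covering [H `<=` B Gamma_v B] provided by
    thickness: any set [S] with [H `<=` B S B], [B] finite, contains two independent
    loxodromics ([nonelementary_of_finite_cover]).  An element [w] of [H] gives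
    [g = b1^-1 w b2^-1] in [S]; up to a bounded error, [g o] lies in the
    direction of [b1^-1 w o] and [g^-1 o] in that of [b2 w^-1 o].  The correction
    terms [b1], [b2] depend on [w] and cannot be prescribed, so [w] has to be
    chosen among enough candidates for all corrections to be harmless.

    Two criteria say what is needed.  If [N g] exceeds twice [P g^-1 g] by a few
    [delta], the orbit of [g] makes definite progress at each step without
    backtracking, and [g] is loxodromic ([quasi_axial_loxodromic]).  If the four
    products of [g^+-1] against [h^+-1] are small compared with [N g] and [N h],
    then [g] and [h] share no fixed point at infinity: a sequence tending to a
    point fixed by [g] must look towards [g o] or [g^-1 o], and likewise for [h]
    ([separated_independent]).  So it is enough to find in [S] two long elements
    [g], [h] such that [g o], [g^-1 o], [h o], [h^-1 o] lie in pairwise separated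
    directions.

    For the supply of candidates, replace the two given loxodromics of [H] by
    powers [f], [k] satisfying the first criterion.  Independence bounds all
    products [P (f^+-p) (k^+-q)], since otherwise the rays of [f] and of [k] would
    define the same boundary point, fixed by both
    ([independent_product_bounded]).  Hence for [m] large and any given [K] the
    elements [u_i = f^(im) k^n f^(im)], [i < K], point in pairwise separated
    directions, as do their inverses, with a separation constant that does not
    depend on [n], whereas [N u_i] tends to infinity with [n]
    ([nonelementary_directions]).

    Let [w = u_i u_j^-1].  The four directions that matter are then of the form
    [s u_i o] with [s] in a finite set determined by [B].  For given [i], [s] and
    [t], at most one [j] makes [t u_j o] close in direction to [s u_i o], because
    two such [j] would be close to each other.  When [K] exceeds a multiple of the
    number of pairs [(s, t)], four indices can therefore be chosen one after the
    other whose translates by all [s], [t] are pairwise separated, whatever the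
    corrections turn out to be; they yield [g] and [h]. *)

Set Implicit Arguments.
Unset Strict Implicit.
Unset Printing Implicit Defensive.

Import Order.TTheory GRing.Theory Num.Theory.
Import numFieldNormedType.Exports.

Local Open Scope classical_set_scope.
Local Open Scope ring_scope.

(** * Gromov products in slim-triangle spaces *)

(** Gromov's inequality [min ((x|y), (y|z)) - delta <= (x|z)], with the minimum
    written as a disjunction so that linear arithmetic can use it directly. *)
Definition four_point {R : realType} (X : metricType R) (delta : R) : Prop :=
  forall o x y z : X,
    gromov_product o x y <= gromov_product o x z + delta \/
    gromov_product o y z <= gromov_product o x z + delta.

Section GromovProduct.
Context {R : realType} (X : metricType R).
Implicit Types (o x y z p : X) (S : set X).

Lemma gromov_productC o x y : gromov_product o x y = gromov_product o y x.
Proof. by rewrite /gromov_product (metric_sym x y) [mdist x o + _]addrC. Qed.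

Lemma gromov_product_ge0 o x y : 0 <= gromov_product o x y.
Proof.
have := metric_triangle x o y; rewrite (metric_sym o y) => h.
by rewrite /gromov_product; lra.
Qed.

Lemma gromov_product_lel o x y : gromov_product o x y <= mdist x o.
Proof.
have := metric_triangle y x o; rewrite (metric_sym y x) => h.
by rewrite /gromov_product; lra.
Qed.

Lemma gromov_product_self o x : gromov_product o x x = mdist x o.
Proof. by rewrite /gromov_product mdistxx; lra. Qed.

(** In the comparison tripod of [o], [x], [y], the side from [o] to [x] is cut by
    the centre into pieces of lengths [(x|y)_o] and [(o|y)_x]. *)
Lemma gromov_product_complement o x y :
  gromov_product o x y + gromov_product x o y = mdist x o.
Proof.
by rewrite /gromov_product (metric_sym o x) (metric_sym y x) (metric_sym y o); lra.
Qed.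

Lemma gromov_product_shift o x y z :
  gromov_product o x y <= gromov_product o x z + mdist y z.
Proof.
have h1 := metric_triangle y z o; have h2 := metric_triangle x y z.
by rewrite /gromov_product; lra.
Qed.

Lemma gromov_product_base o p x y :
  gromov_product o x y <= gromov_product p x y + mdist o p.
Proof.
have h1 := metric_triangle x p o; have h2 := metric_triangle y p o.
by rewrite /gromov_product; rewrite (metric_sym o p); lra.
Qed.

Lemma geodesic_segment_split x y p S : geodesic_segment x y S -> S p ->
  mdist x p + mdist p y = mdist x y.
Proof.
case=> gam [<- gy giso ->] [t /= t01 <-].
move: (t01); rewrite in_itv /= => /andP[t0 t1].
have h0 : 0 \in `[0, mdist (gam 0) y] by rewrite in_itv /= lexx mdist_ge0.
have h1 : mdist (gam 0) y \in `[0, mdist (gam 0) y].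
  by rewrite in_itv /= lexx mdist_ge0.
have := giso _ _ h0 t01; have := giso _ _ t01 h1; rewrite gy => -> ->.
rewrite sub0r normrN distrC !ger0_norm ?subr_ge0 //.
by lra.
Qed.

Lemma gromov_product_le_segment o x y p S : geodesic_segment x y S -> S p ->
  gromov_product o x y <= mdist p o.
Proof.
move=> seg Sp; have h := geodesic_segment_split seg Sp.
have h1 := metric_triangle x p o; have h2 := metric_triangle y p o.
by rewrite (metric_sym y p) in h2; rewrite /gromov_product; lra.
Qed.

(** The reverse of [gromov_product_le_segment] for a point of [[x, y]] that is
    [e]-close to both other sides: a detour through [p] lengthens each of these
    sides by at most [2 * e], and the product halves the sum. *)
Lemma gromov_product_near_segments o x y p q q' Sx Sy e :
  geodesic_segment o x Sx -> geodesic_segment y o Sy -> Sx q -> Sy q' ->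
  mdist p q <= e -> mdist p q' <= e ->
  mdist x p + mdist p y = mdist x y ->
  mdist p o <= gromov_product o x y + 2 * e.
Proof.
move=> sx sy Sq Sq' pq pq' pxy.
have hx := geodesic_segment_split sx Sq.
have hy := geodesic_segment_split sy Sq'.
have := metric_triangle x q p; have := metric_triangle p q o.
have := metric_triangle p q' y; have := metric_triangle p q' o.
move: hx hy pq pq' pxy; rewrite /gromov_product.
rewrite (metric_sym o x) (metric_sym o q) (metric_sym x q) (metric_sym q' y).
rewrite (metric_sym q p) (metric_sym x p) (metric_sym p y).
by lra.
Qed.

(** Moving along [[x, y]], the side [[o, x]] is close at the start and [[y, o]] at
    the end, so a point where one hands over to the other is close to both.
    Sampling at steps of length at most 1 finds it without a continuity
    argument, which is where the extra 1 comes from. *)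
Lemma segment_center (delta : R) o x y A B C :
  geodesic_segment x y A -> geodesic_segment y o B -> geodesic_segment o x C ->
  0 <= delta -> A `<=` neighborhood delta (B `|` C) ->
  exists2 p, A p & mdist p o <= gromov_product o x y + 2 * (delta + 1).
Proof.
move=> sA sB sC d0 thin.
have [gam [g0 gd giso EA]] := sA.
set L := mdist x y in gd giso EA; have L0 : 0 <= L by exact: mdist_ge0.
have itv (i : nat) : Num.min i%:R L \in `[0, L].
  by rewrite in_itv /= le_min ler0n L0 ge_min lexx orbT.
pose pt (i : nat) := gam (Num.min i%:R L).
have Apt i : A (pt i) by rewrite EA; exact/imageP/itv.
pose Q (i : nat) := `[< exists2 q, C q & mdist (pt i) q <= delta >].
have Cx : C x.
  case: sC => g [_ gx _ ->] /=.
  by exists (mdist o x) => //=; rewrite in_itv /= lexx mdist_ge0.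
have By : B y.
  case: sB => g [gy _ _ ->] /=.
  by exists 0 => //=; rewrite in_itv /= lexx mdist_ge0.
have Q0 : Q 0%N.
  by apply/asboolP; exists x; rewrite // /pt min_l // g0 mdistxx.
(* [Q i]: the [i]-th sample point is close to [[o, x]]; the handover happens just
   before the first [i] where this fails, or at [y] if it never fails. *)
have [exQ|allQ] := pselect (exists i, ~~ Q i).
  have [[|i] nQ minQ] := ex_minnP exQ; first by rewrite Q0 in nQ.
  have Qi : Q i by apply/negPn/negP => /minQ; rewrite ltnn.
  have /asboolP[q Cq dq] := Qi.
  have [q' [Bq'|Cq'] dq'] := thin _ (Apt i.+1); last first.
    by case/negP: nQ; apply/asboolP; exists q'.
  exists (pt i) => //.
  have step : mdist (pt i) (pt i.+1) <= 1.
    rewrite /pt giso // /Num.min.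
    have -> : (i.+1%:R = i%:R + 1 :> R) by rewrite -natr1.
    by do 2 case: ifPn; rewrite -?leNgt => *; rewrite ler_norml;
      apply/andP; split; lra.
  apply: (gromov_product_near_segments sC sB Cq Bq').
  - by lra.
  - by have := metric_triangle (pt i) (pt i.+1) q'; lra.
  - exact: geodesic_segment_split sA (Apt i).
have Qn : Q (Num.Def.archi_bound L).
  by apply/negPn/negP => h; apply: allQ; eexists; exact: h.
move/asboolP: Qn => -[q Cq]; rewrite /pt min_r; last first.
  exact/ltW/archi_boundP.
rewrite gd => dq; exists y.
  by rewrite EA /=; exists L => //=; rewrite in_itv /= lexx L0.
apply: (gromov_product_near_segments sC sB Cq By).
- by lra.
- by rewrite mdistxx; lra.
- by rewrite mdistxx addr0.
Qed.

(** [(x|z)_o] is, up to a constant, the distance from [o] to [[z, x]]; a point of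
    [[z, x]] nearly realizing it is close to [[x, y]] or to [[y, z]], and the
    distance from [o] to these is at least the corresponding product. *)
Theorem hyperbolic_four_point : hyperbolic_space X ->
  exists2 delta, 0 <= delta & four_point X delta.
Proof.
case=> geo [delta d0 thin]; exists (3 * delta + 2); first by lra.
move=> o x y z.
have [A sA] := geo x y; have [B sB] := geo y z; have [C sC] := geo z x.
have [_ _ thinC] := thin _ _ _ _ _ _ sA sB sC.
have [B' sB'] := geo x o; have [C' sC'] := geo o z.
have [thinC' _ _] := thin _ _ _ _ _ _ sC sB' sC'.
have [p Cp po] := segment_center sC sB' sC' d0 thinC'.
rewrite gromov_productC in po.
have [q [Aq|Bq] pq] := thinC _ Cp; [left|right].
  have h := gromov_product_le_segment o sA Aq.
  by have := metric_triangle q p o; rewrite (metric_sym q p); lra.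
have h := gromov_product_le_segment o sB Bq.
by have := metric_triangle q p o; rewrite (metric_sym q p); lra.
Qed.

End GromovProduct.

(** * Loxodromic isometries *)

(** Fekete's lemma: the limit is the infimum of [u n / n], and Euclidean division
    of [n] by a nearly optimal index bounds [u n / n] from above.  The linear
    lower bound keeps the infimum positive. *)
Lemma subadditive_cvg {R : realType} (u : nat -> R) (e : R) :
  u 0%N = 0 -> (forall m n, u (m + n)%N <= u m + u n) ->
  0 < e -> (forall n, e * n%:R <= u n) ->
  exists2 l : R, 0 < l & u n / n%:R @[n --> \oo] --> l.
Proof.
move=> u0 usub e0 ue.
pose E := [set u n.+1 / n.+1%:R | n in [set: nat]].
have lbE : lbound E e by move=> _ [n _ <-]; rewrite ler_pdivlMr ?ltr0Sn.
have nE : E !=set0 by exists (u 1 / 1%:R); exists 0%N.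
have infE : has_inf E by split=> //; exists e.
have l0 : 0 < inf E by apply: (lt_le_trans e0); exact: lb_le_inf.
have umul n m : u (n * m)%N <= n%:R * u m.
  elim: n => [|n IH]; first by rewrite mul0n u0 mul0r.
  by have := usub m (n * m)%N; rewrite mulSn -natr1; lra.
exists (inf E) => //; apply/cvgrPdist_le => eps eps0.
have [_ [N _ <-] uN] := inf_adherent (divr_gt0 eps0 (ltr0Sn R 1)) infE.
rewrite ltr_pdivrMr ?ltr0Sn // in uN.
near=> n.
have n1 : (1 <= n)%N by near: n; exact: nbhs_infty_ge.
have n0 : 0 < n%:R :> R by rewrite ltr0n.
have large : 2 / eps * (N.+1%:R * u 1%N) <= n%:R by near: n; exact: nbhs_infty_ger.
have lo : inf E <= u n / n%:R.
  by apply: ge_inf; [exists e | exists n.-1; rewrite // prednK].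
have hi : u n / n%:R <= inf E + eps.
  rewrite ler_pdivrMr //.
  have Nq := divn_eq n N.+1.
  set q := (n %/ N.+1)%N in Nq; set r := (n %% N.+1)%N in Nq.
  have rN : r%:R <= N.+1%:R :> R by rewrite ler_nat ltnW // ltn_pmod.
  have := usub (q * N.+1)%N r; rewrite -Nq => h1.
  have h2 := umul q N.+1.
  have h3 := umul r 1%N; rewrite muln1 in h3.
  have u1 : 0 <= u 1%N by have := ue 1%N; rewrite mulr1; lra.
  have h4 : r%:R * u 1%N <= N.+1%:R * u 1%N by rewrite ler_wpM2r.
  have h5 : q%:R * u N.+1 <= q%:R * ((inf E + eps / 2) * N.+1%:R).
    by rewrite ler_wpM2l ?ler0n // ltW.
  have h6 : (q%:R * N.+1%:R) * (inf E + eps / 2) <= n%:R * (inf E + eps / 2).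
    by rewrite ler_wpM2r //; [lra | rewrite -natrM ler_nat [leqRHS]Nq leq_addr].
  have h7 : N.+1%:R * u 1%N <= eps / 2 * n%:R.
    have := ler_wpM2l (ltW (divr_gt0 eps0 (ltr0Sn R 1))) large.
    by rewrite !mulrA mulfVK ?mulfV ?mul1r ?lt0r_neq0.
  by lra.
by rewrite ler_norml; apply/andP; split; lra.
Unshelve. all: by end_near. Qed.

Section Orbit.
Context {R : realType} {G : groupType} {X : metricType R} (act : G -> X -> X).
Context (isom : isometric_action act).
Implicit Types (g h b t f : G) (o x y : X).

Definition displacement o g : R := mdist (act g o) o.

Definition orbit_product o g h : R := gromov_product o (act g o) (act h o).

Local Notation N := displacement.
Local Notation P := orbit_product.

Lemma act1 x : act 1%g x = x. Proof. by case: isom. Qed.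
Lemma actM g h x : act (g * h)%g x = act g (act h x). Proof. by case: isom. Qed.
Lemma mdist_act g x y : mdist (act g x) (act g y) = mdist x y.
Proof. by case: isom. Qed.
Lemma actVK g x : act g (act g^-1%g x) = x. Proof. by rewrite -actM mulgV act1. Qed.
Lemma actKV g x : act g^-1%g (act g x) = x. Proof. by rewrite -actM mulVg act1. Qed.

Lemma gromov_product_act g o x y :
  gromov_product (act g o) (act g x) (act g y) = gromov_product o x y.
Proof. by rewrite /gromov_product !mdist_act. Qed.

Lemma displacement1 o : N o 1%g = 0. Proof. by rewrite /N act1 mdistxx. Qed.
Lemma displacement_ge0 o g : 0 <= N o g. Proof. exact: mdist_ge0. Qed.
Lemma displacementV o g : N o g^-1%g = N o g.
Proof. by rewrite /N -(mdist_act g) actVK metric_sym. Qed.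
Lemma displacementM o g h : N o (g * h)%g <= N o g + N o h.
Proof.
by rewrite /N actM -[X in _ + X](mdist_act g) addrC metric_triangle.
Qed.

Lemma orbit_productC o g h : P o g h = P o h g.
Proof. exact: gromov_productC. Qed.
Lemma orbit_product_ge0 o g h : 0 <= P o g h.
Proof. exact: gromov_product_ge0. Qed.
Lemma orbit_product_lel o g h : P o g h <= N o g.
Proof. exact: gromov_product_lel. Qed.
Lemma orbit_product_ler o g h : P o g h <= N o h.
Proof. by rewrite orbit_productC orbit_product_lel. Qed.
Lemma orbit_product_self o g : P o g g = N o g.
Proof. exact: gromov_product_self. Qed.

(** The tripod identity for [o], [g o], [g h o], moved by [g^-1]: the product
    [P g (g h)] is large exactly when [h o] avoids the direction of [g^-1 o]. *)
Lemma orbit_product_turn o g h : P o g (g * h)%g + P o g^-1%g h = N o g.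
Proof.
rewrite -[RHS](gromov_product_complement o (act g o) (act (g * h)%g o)); congr (_ + _).
by rewrite /P -(gromov_product_act g) actVK -actM.
Qed.

Lemma orbit_product_mulr o g h t : P o g (h * t)%g <= P o g h + N o t.
Proof.
rewrite /P /N; apply: le_trans (gromov_product_shift _ _ _ (act h o)) _.
by rewrite actM mdist_act.
Qed.

Lemma orbit_product_mull o b g h : P o (b * g)%g (b * h)%g <= P o g h + N o b.
Proof.
rewrite /P -(gromov_product_act b o (act g o)) -!actM -[N o b]metric_sym.
exact: gromov_product_base.
Qed.

Lemma orbit_product_mull_ge o b g h : P o g h <= P o (b * g)%g (b * h)%g + N o b.
Proof.
have := orbit_product_mull o b^-1%g (b * g) (b * h).
by rewrite !mulKg displacementV.
Qed.

Lemma displacement_turn o g h :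
  N o (g * h)%g = N o g + N o h - 2 * P o g^-1%g h.
Proof.
have -> : N o (g * h)%g = mdist (act g^-1%g o) (act h o).
  by rewrite -(mdist_act g) actVK -actM metric_sym.
rewrite /P /gromov_product -/(N o g^-1%g) displacementV -/(N o h).
by rewrite -[N o g](displacementV); rewrite /N; lra.
Qed.

Context (delta : R) (d0 : 0 <= delta) (fp : four_point X delta).

Lemma orbit_four_point o g h k :
  P o g h <= P o g k + delta \/ P o h k <= P o g k + delta.
Proof. exact: fp. Qed.

(** The broken geodesic through [f^-1 o], [o], [f o] turns at [o] by a bounded
    amount compared with the length of its sides.  The margin of [3 * delta] is
    what the local-to-global principle below consumes. *)
Definition quasi_axial o f : Prop := 2 * P o f^-1%g f + 3 * delta < N o f.

Lemma quasi_axialV o f : quasi_axial o f -> quasi_axial o f^-1%g.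
Proof. by rewrite /quasi_axial displacementV invgK orbit_productC. Qed.

(** Local-to-global principle.  By induction [f^(n+2) o] is far out in the direction
    of [f o], since the turn of the path at [f o] is bounded; as [f^-1 o] and [f o]
    are separated, so are [f^-1 o] and [f^(n+2) o]. *)
Lemma quasi_axial_turn o f n : quasi_axial o f ->
  P o f^-1%g (f ^+ n)%g <= P o f^-1%g f + delta.
Proof.
move=> qf; have P0 := orbit_product_ge0 o f^-1%g f.
case: n => [|n].
  have := orbit_product_ler o f^-1%g (f ^+ 0)%g; rewrite expg0 displacement1.
  by move: d0; lra.
elim: n => [|n IH]; first by move: d0; rewrite expg1; lra.
have := orbit_product_turn o f (f ^+ n.+1)%g; rewrite -expgS => turn.
have := orbit_four_point o f^-1%g (f ^+ n.+2)%g f.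
rewrite [P o (f ^+ n.+2)%g f]orbit_productC.
by move: qf d0; rewrite /quasi_axial; lra.
Qed.

(** Each new step loses at most twice the turn bound, hence a linear rate. *)
Lemma quasi_axial_displacement o f n : quasi_axial o f ->
  (N o f - 2 * P o f^-1%g f - 2 * delta) * n%:R <= N o (f ^+ n)%g.
Proof.
move=> qf; elim: n => [|n IH]; first by rewrite mulr0 displacement_ge0.
rewrite expgS displacement_turn -natr1.
by have := quasi_axial_turn n qf; lra.
Qed.

Lemma quasi_axial_rate_gt0 o f : quasi_axial o f ->
  0 < N o f - 2 * P o f^-1%g f - 2 * delta.
Proof. by move: d0; rewrite /quasi_axial; lra. Qed.

(** The same argument on the other side: [f^-i o] is far out in the direction of
    [f^-1 o], which is separated from [f^k o]. *)
Lemma quasi_axial_turns o f i k : quasi_axial o f ->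
  P o (f^-1 ^+ i)%g (f ^+ k)%g <= P o f^-1%g f + 2 * delta.
Proof.
move=> qf; have P0 := orbit_product_ge0 o f^-1%g f.
case: i => [|i].
  have := orbit_product_lel o (f^-1 ^+ 0)%g (f ^+ k)%g; rewrite expg0 displacement1.
  by move: d0; lra.
have := orbit_product_turn o f^-1%g (f^-1 ^+ i)%g; rewrite -expgS displacementV.
have := quasi_axial_turn i (quasi_axialV qf); rewrite orbit_productC !invgK.
rewrite [P o f _]orbit_productC => h1 h2.
have := quasi_axial_turn k qf.
have := orbit_four_point o f^-1%g (f^-1 ^+ i.+1)%g (f ^+ k)%g.
by move: d0; move: qf; rewrite /quasi_axial; lra.
Qed.

Lemma quasi_axial_ray o f i j : quasi_axial o f -> (i <= j)%N ->
  N o (f ^+ i)%g - P o f^-1%g f - 2 * delta <= P o (f ^+ i)%g (f ^+ j)%g.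
Proof.
move=> qf ij; have := orbit_product_turn o (f ^+ i)%g (f ^+ (j - i))%g.
rewrite -expgnDr subnKC // -expVgn => h.
by have := quasi_axial_turns i (j - i) qf; lra.
Qed.

Lemma quasi_axial_loxodromic o f : quasi_axial o f -> loxodromic act f.
Proof.
move=> qf; exists o; apply: (subadditive_cvg _ _ (quasi_axial_rate_gt0 qf)).
- by rewrite expg0; exact: displacement1.
- by move=> m n; rewrite expgnDr; exact: displacementM.
- by move=> n; exact: quasi_axial_displacement.
Qed.

(** Changing the base point changes displacements by a bounded amount, so the
    growth rate can be read off at any base point. *)
Lemma loxodromic_displacement g o : loxodromic act g -> exists2 l : R, 0 < l &
  forall e, 0 < e -> exists n0, forall n, (n0 <= n)%N ->
    (l - e) * n%:R <= N o (g ^+ n)%g <= (l + e) * n%:R.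
Proof.
case=> x [l l0 /cvgrPdist_le cv]; exists l => // e e0.
have e20 : 0 < e / 2 by lra.
have [n1 _ h1] := cv _ e20.
have [n2 _ h2] := @nbhs_infty_ger R (2 / e * (2 * mdist x o)).
exists (maxn 1 (maxn n1 n2)) => n; rewrite !geq_max => /and3P[n0 /h1 /= + /h2 /= large].
have n0' : 0 < n%:R :> R by rewrite ltr0n.
rewrite ler_norml => /andP[a b].
have {}a : mdist (act (g ^+ n)%g x) x <= (l + e / 2) * n%:R.
  by rewrite -ler_pdivrMr //; lra.
have {}b : (l - e / 2) * n%:R <= mdist (act (g ^+ n)%g x) x.
  by rewrite -ler_pdivlMr //; lra.
have {}large : 2 * mdist x o <= e / 2 * n%:R.
  have := ler_wpM2l (ltW e20) large.
  by rewrite !mulrA mulfVK ?mulfV ?mul1r ?lt0r_neq0.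
set gn := (g ^+ n)%g in a b *; rewrite /N.
have t1 := metric_triangle (act gn o) (act gn x) o.
have t2 := metric_triangle (act gn x) x o.
have t3 := metric_triangle (act gn x) (act gn o) x.
have t4 := metric_triangle (act gn o) o x.
move: t1 t2 t3 t4; rewrite !mdist_act (metric_sym o x) => *.
by apply/andP; split; lra.
Qed.

(** Since [N (g^n)] and [N (g^(2n)) / 2] are both [l * n] up to a small proportion,
    [P (g^-n) (g^n) = N (g^n) - N (g^(2n)) / 2] is a small proportion of
    [N (g^n)]. *)
Lemma loxodromic_quasi_axial g o : loxodromic act g ->
  exists n, quasi_axial o (g ^+ n)%g.
Proof.
move=> /(loxodromic_displacement o)[l l0 growth].
(* With an error of [l / 10], [N (g^n)] is at least [9/10 * l * n] and twice the
   product is at most [4/10 * l * n]. *)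
have l10 : 0 < l / 10 by lra.
have [n0 h0] := growth _ l10.
have [n1 _ h1] := @nbhs_infty_ger R (10 / l * (3 * delta + 1)).
exists (maxn n0 n1); set n := maxn _ _.
have /h1 /= large : (n1 <= n)%N by rewrite leq_maxr.
have /h0/andP[lo1 hi1] : (n0 <= n)%N by rewrite leq_maxl.
have /h0/andP[lo2 hi2] : (n0 <= n + n)%N.
  exact: leq_trans (leq_maxl _ _) (leq_addr _ _).
have := ler_wpM2l (ltW l10) large; rewrite !mulrA.
have -> : l / 10 * 10 / l = 1 by rewrite divfK ?pnatr_eq0 ?mulfV ?lt0r_neq0.
rewrite mul1r => {}large.
have := displacement_turn o (g ^+ n)%g (g ^+ n)%g; rewrite -expgnDr => dt.
rewrite natrD in lo2 hi2; rewrite /quasi_axial.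
by move: d0; lra.
Qed.

End Orbit.

(** * Points at infinity and independence *)

(** Uniformity in the base point comes for free, products at two base points
    differing by at most their distance. *)
Lemma gromov_asymptoticP {R : realType} (X : metricType R) (o : X)
    (u v : nat -> X) :
  gromov_asymptotic u v <->
  forall M : R, exists n0, forall i j, (n0 <= i)%N -> (n0 <= j)%N ->
    M <= gromov_product o (u i) (v j).
Proof.
split=> [/(_ o)/cvgryPge asym M|asym p].
  have [[A B] /= [[n1 _ A1] [n2 _ B2]] AB] := asym M.
  exists (maxn n1 n2) => i j; rewrite !geq_max => /andP[i1 _] /andP[_ j2].
  by apply: (AB (i, j)); split; [exact: A1 | exact: B2].
apply/cvgryPge => M; have [n0 h0] := asym (M + mdist o p).
exists ([set i | (n0 <= i)%N], [set j | (n0 <= j)%N]) => /=.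
  by split; exists n0.
move=> [i j] [/= i0 j0]; have := h0 _ _ i0 j0.
by have := gromov_product_base o p (u i) (v j); lra.
Qed.

Section Boundary.
Context {R : realType} {G : groupType} {X : metricType R} (act : G -> X -> X).
Context (isom : isometric_action act).
Context (delta : R) (d0 : 0 <= delta) (fp : four_point X delta).
Implicit Types (g h f k : G) (o x y : X) (u v w : nat -> X).

Local Notation N := (displacement act).
Local Notation P := (orbit_product act).

Definition boundary_class u : set (nat -> X) :=
  [set v | gromov_sequence v /\ gromov_asymptotic u v].

Lemma gromov_asymptotic_sym u v : gromov_asymptotic u v -> gromov_asymptotic v u.
Proof.
move=> uv; apply/(gromov_asymptoticP (u 0%N)) => M.
have [n0 h0] := (gromov_asymptoticP (u 0%N) u v).1 uv M.
by exists n0 => i j i0 j0; rewrite gromov_productC; exact: h0.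
Qed.

Lemma gromov_asymptotic_trans u v w :
  gromov_asymptotic u v -> gromov_asymptotic v w -> gromov_asymptotic u w.
Proof.
set o := u 0%N.
move=> /(gromov_asymptoticP o) uv /(gromov_asymptoticP o) vw.
apply/(gromov_asymptoticP o) => M.
have [n1 h1] := uv (M + delta); have [n2 h2] := vw (M + delta).
exists (maxn n1 n2) => i j; rewrite !geq_max => /andP[i1 i2] /andP[j1 j2].
have := h1 _ _ i1 i1; have := h2 _ _ i2 j2.
by have := fp o (u i) (v i) (w j); lra.
Qed.

Lemma gromov_asymptotic_act g u v :
  gromov_asymptotic u v -> gromov_asymptotic (act g \o u) (act g \o v).
Proof.
set o := u 0%N; move=> /(gromov_asymptoticP o) uv.
apply/(gromov_asymptoticP (act g o)) => M; have [n0 h0] := uv M.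
by exists n0 => i j i0 j0; rewrite /= gromov_product_act //; exact: h0.
Qed.

(** A fixed point must be fixed as a set of sequences; the inclusion
    [xi `<=` g xi] comes from translating a representative by [g^-1]. *)
Lemma boundary_class_fixed g u :
  gromov_sequence u -> gromov_asymptotic u (act g \o u) ->
  boundary_fixed_points act g (boundary_class u).
Proof.
move=> gu ugu; split; first by exists u.
have gVu : gromov_asymptotic u (act g^-1%g \o u).
  have := gromov_asymptotic_act g^-1%g ugu.
  have -> : act g^-1%g \o (act g \o u) = u.
    by apply/funext => n /=; rewrite actKV.
  exact: gromov_asymptotic_sym.
rewrite eqEsubset; split=> [_ [v [gv uv] <-]|w [gw uw]].
  split; first exact: gromov_asymptotic_act gv.
  exact: gromov_asymptotic_trans ugu (gromov_asymptotic_act g uv).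
exists (act g^-1%g \o w); last by apply/funext => n /=; rewrite actVK.
split; first exact: gromov_asymptotic_act gw.
exact: gromov_asymptotic_trans gVu (gromov_asymptotic_act g^-1%g uw).
Qed.

Lemma boundary_fixed_asymptotic g xi : boundary_fixed_points act g xi ->
  forall u, gromov_sequence u -> xi = boundary_class u ->
  gromov_asymptotic u (act g \o u).
Proof.
case=> _ fixg u gu xiE.
have : xi (act g \o u) by rewrite -fixg; exists u => //; rewrite xiE.
by rewrite xiE => -[].
Qed.

Lemma quasi_axial_ray_min o f i j : quasi_axial act delta o f ->
  N o (f ^+ i)%g - P o f^-1%g f - 2 * delta <= P o (f ^+ i)%g (f ^+ j)%g \/
  N o (f ^+ j)%g - P o f^-1%g f - 2 * delta <= P o (f ^+ i)%g (f ^+ j)%g.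
Proof.
move=> qf; have [ij|/ltnW ji] := leqP i j; [left|right].
  exact: quasi_axial_ray.
by rewrite [P o (f ^+ i)%g _]orbit_productC; exact: quasi_axial_ray.
Qed.

Lemma quasi_axial_unbounded o f (M : R) : quasi_axial act delta o f ->
  exists n0, forall n, (n0 <= n)%N -> M <= N o (f ^+ n)%g.
Proof.
move=> qf; have r0 := quasi_axial_rate_gt0 d0 qf; set r := (X in 0 < X) in r0.
have [n0 _ h0] := @nbhs_infty_ger R (M / r).
exists n0 => n /h0 /=; rewrite ler_pdivrMr // mulrC => h.
exact: le_trans h (quasi_axial_displacement isom d0 fp n qf).
Qed.

Lemma quasi_axial_gromov_sequence o f : quasi_axial act delta o f ->
  gromov_sequence (fun n => act (f ^+ n)%g o).
Proof.
move=> qf; apply/(gromov_asymptoticP o) => M.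
have [n0 h0] := quasi_axial_unbounded (M + P o f^-1%g f + 2 * delta) qf.
exists n0 => i j /h0 hi /h0 hj; have := quasi_axial_ray_min i j qf.
by rewrite /orbit_product in hi hj *; lra.
Qed.

(** The element [f] is a power of [g], or the inverse of one, in the application:
    since [g] commutes with [f], it moves every [f^n o] by the same
    distance [N g], and hence fixes the point at infinity of the orbit.  This
    avoids relating the fixed points of [g] to those of [f]. *)
Lemma quasi_axial_endpoint o f g : quasi_axial act delta o f -> commute f g ->
  boundary_fixed_points act g (boundary_class (fun n => act (f ^+ n)%g o)).
Proof.
move=> qf fg; apply: boundary_class_fixed; first exact: quasi_axial_gromov_sequence.
have /(gromov_asymptoticP o) gs := quasi_axial_gromov_sequence qf.
apply/(gromov_asymptoticP o) => M; have [n0 h0] := gs (M + N o g).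
exists n0 => i j i0 j0; have := h0 _ _ i0 j0; rewrite /= -actM //.
have -> : (g * f ^+ j = f ^+ j * g)%g by apply/commuteX/commute_sym.
have := orbit_product_mulr isom o (f ^+ i)%g (f ^+ j * g)%g g^-1%g.
by rewrite mulgK displacementV // /orbit_product; lra.
Qed.

(** If some [f^m o] and [k^n o] have a large product, then so do [f^i o] and
    [k^j o] for all large [i], [j], because the orbits are rays.  Were the
    products unbounded, both rays would end at one point, fixed by [g] and [h]. *)
Lemma independent_product_bounded o f k g h :
  quasi_axial act delta o f -> quasi_axial act delta o k ->
  commute f g -> commute k h -> independent act g h ->
  exists C, forall m n, P o (f ^+ m)%g (k ^+ n)%g <= C.
Proof.
move=> qf qk fg kh ind; apply: contrapT => unbounded.
have {}unbounded C : exists m n, C <= P o (f ^+ m)%g (k ^+ n)%g.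
  apply: contrapT => bounded; apply: unbounded; exists C => m n.
  by rewrite leNgt; apply/negP => /ltW h1; apply: bounded; exists m, n.
pose u n := act (f ^+ n)%g o; pose v n := act (k ^+ n)%g o.
have uv : gromov_asymptotic u v.
  apply/(gromov_asymptoticP o) => M.
  pose A := P o f^-1%g f; pose B := P o k^-1%g k.
  have A0 : 0 <= A by exact: orbit_product_ge0.
  have B0 : 0 <= B by exact: orbit_product_ge0.
  have [n1 h1] := quasi_axial_unbounded (`|M| + A + B + 4 * delta) qf.
  have [n2 h2] := quasi_axial_unbounded (`|M| + A + B + 4 * delta) qk.
  exists (maxn n1 n2) => i j; rewrite !geq_max => /andP[/h1 i1 _] /andP[_ /h2 j2].
  have [m [n mn]] := unbounded (`|M| + A + B + 4 * delta).
  have := orbit_product_lel act o (f ^+ m)%g (k ^+ n)%g.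
  have := orbit_product_ler act o (f ^+ m)%g (k ^+ n)%g.
  have := quasi_axial_ray_min i m qf; have := quasi_axial_ray_min n j qk.
  have := orbit_four_point act fp o (f ^+ i)%g (f ^+ m)%g (k ^+ j)%g.
  have := orbit_four_point act fp o (f ^+ m)%g (k ^+ n)%g (k ^+ j)%g.
  rewrite -/(P o (f ^+ i)%g (k ^+ j)%g) -/A -/B.
  have := ler_norm M; move: d0; lra.
have : (boundary_fixed_points act g `&` boundary_fixed_points act h)
       (boundary_class u).
  split; first exact: quasi_axial_endpoint qf fg.
  have -> : boundary_class u = boundary_class v.
    rewrite eqEsubset; split=> w [gw uw]; split => //.
      exact: gromov_asymptotic_trans (gromov_asymptotic_sym uv) uw.
    exact: gromov_asymptotic_trans uv uw.
  exact: quasi_axial_endpoint qk kh.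
by rewrite ind.
Qed.

(** Ping-pong: if [x] is seen from [o] neither towards [g o] nor towards [g^-1 o],
    then [g] sends [x] towards [g o], away from [x]. *)
Lemma almost_fixed_direction o g x C :
  2 * C + delta < N o g -> C + delta < gromov_product o x (act g x) ->
  C < gromov_product o x (act g o) \/ C < gromov_product o x (act g^-1%g o).
Proof.
move=> gC xC; have := gromov_product_complement o (act g o) (act g x).
have := gromov_product_act isom g (act g^-1%g o) o x.
have := gromov_product_act isom g o x (act g^-1%g o).
have := fp o x (act g x) (act g o).
rewrite actVK // -/(N o g).
rewrite (gromov_productC o (act g x) (act g o)) (gromov_productC (act g o) (act g x)).
by lra.
Qed.

(** A sequence converging to a common fixed point would eventually be seen both
    towards one of [g o], [g^-1 o] and towards one of [h o], [h^-1 o], although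
    these directions are separated. *)
Lemma separated_independent o g h C :
  2 * C + 3 * delta < N o g -> 2 * C + 3 * delta < N o h ->
  P o g h <= C -> P o g h^-1%g <= C -> P o g^-1%g h <= C -> P o g^-1%g h^-1%g <= C ->
  independent act g h.
Proof.
move=> gC hC c1 c2 c3 c4; rewrite /independent -subset0 => xi [fg fh].
have [u gu xiE] : gromov_boundary xi by case: fg.
have /(gromov_asymptoticP o) /(_ (C + 2 * delta + 1)) [n1 h1] :=
  boundary_fixed_asymptotic fg gu xiE.
have /(gromov_asymptoticP o) /(_ (C + 2 * delta + 1)) [n2 h2] :=
  boundary_fixed_asymptotic fh gu xiE.
pose n := maxn n1 n2; have l1 : (n1 <= n)%N := leq_maxl _ _.
have l2 : (n2 <= n)%N := leq_maxr _ _.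
have {}h1 := h1 _ _ l1 l1; have {}h2 := h2 _ _ l2 l2; rewrite /= in h1 h2.
have a1 : 2 * (C + delta) + delta < N o g by lra.
have a2 : 2 * (C + delta) + delta < N o h by lra.
have near_g := almost_fixed_direction (x := u n) a1.
have near_h := almost_fixed_direction (x := u n) a2.
have meet a b : C + delta < gromov_product o (u n) (act a o) ->
    C + delta < gromov_product o (u n) (act b o) -> C < P o a b.
  have := fp o (act a o) (u n) (act b o).
  rewrite (gromov_productC o (act a o) (u n)).
  by rewrite /orbit_product; lra.
have [ng|ng] := near_g ltac:(lra); have [nh|nh] := near_h ltac:(lra);
  by have := meet _ _ ng nh; lra.
Qed.

End Boundary.

(** * Separated directions and the choice of the loxodromics *)

Lemma avoid_unique_bad {T I : eqType} (ts : seq T) (xs : seq I)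
    (bad : T -> I -> Prop) :
  uniq xs -> (size ts < size xs)%N ->
  (forall t x y, t \in ts -> x \in xs -> y \in xs ->
    bad t x -> bad t y -> x = y) ->
  exists2 x, x \in xs & forall t, t \in ts -> ~ bad t x.
Proof.
elim: ts xs => [|t ts IH] xs.
  by case: xs => // x xs _ _ _; exists x; rewrite ?mem_head.
move=> uxs sz ubad.
have [[x xxs badx]|nbad] := pselect (exists2 x, x \in xs & bad t x).
  have [||t' y z t'ts|y] := IH (rem x xs).
  - exact: rem_uniq.
  - by rewrite size_rem //; case: (size xs) sz.
  - by move=> /mem_rem yxs /mem_rem zxs; apply: ubad => //; rewrite inE t'ts orbT.
  rewrite mem_rem_uniq // inE => /andP[yx yxs] good; exists y => // t'.
  rewrite inE => /orP[/eqP-> bady|]; last exact: good.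
  by case/eqP: yx; apply: ubad bady badx; rewrite ?mem_head.
have [||y yxs good] := IH xs uxs; first exact: ltnW.
  by move=> t' x y t'ts; apply: ubad; rewrite inE t'ts orbT.
exists y => // t'; rewrite inE => /orP[/eqP-> bady|]; last exact: good.
by apply: nbad; exists y.
Qed.

Section Directions.
Context {R : realType} {G : groupType} {X : metricType R} (act : G -> X -> X).
Context (isom : isometric_action act).
Context (delta : R) (d0 : 0 <= delta) (fp : four_point X delta).
Implicit Types (g h f k : G) (o : X).

Local Notation N := (displacement act).
Local Notation P := (orbit_product act).

Lemma displacementX o g n : N o (g ^+ n)%g <= n%:R * N o g.
Proof.
elim: n => [|n IH]; first by rewrite expg0 displacement1 // mul0r.
have := displacementM isom o g (g ^+ n)%g.
by rewrite expgS -natr1; lra.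
Qed.

(** The prefix [f^(im)] moves the direction of [k^n o] to distinct places for
    distinct [i]; the equal suffix makes [(spread f k m n i)^-1] of the same form
    in [f^-1] and [k^-1]. *)
Definition spread f k m n i : G := (f ^+ (i * m) * k ^+ n * f ^+ (i * m))%g.

Lemma spreadV f k m n i : (spread f k m n i)^-1%g = spread f^-1%g k^-1%g m n i.
Proof. by rewrite /spread !invgM !expVgn mulgA. Qed.

(** After removing the common prefix, and the suffixes, of length at most [D]
    each, it remains to separate [k^n o] from [f^p k^n o] with [p >= m]: the latter
    point lies in the direction of [f^p o], far from that of [k^n o]. *)
Lemma spread_separated o f k C D m n i j :
  (forall p q, P o (f ^+ p)%g (k ^+ q)%g <= C) ->
  (forall p q, P o (f^-1 ^+ p)%g (k ^+ q)%g <= C) ->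
  (forall p, (m <= p)%N -> 2 * C + delta < N o (f ^+ p)%g) ->
  N o (f ^+ (i * m))%g <= D -> N o (f ^+ (j * m))%g <= D ->
  (i < j)%N ->
  P o (spread f k m n i) (spread f k m n j) <= 3 * D + C + delta.
Proof.
move=> fk fVk far Di Dj ij.
pose p := ((j - i) * m)%N.
have jE : (j * m = i * m + p)%N by rewrite -mulnDl subnKC // ltnW.
have fp_far : 2 * C + delta < N o (f ^+ p)%g.
  by apply: far; rewrite leq_pmull // subn_gt0.
have -> : spread f k m n j
    = (f ^+ (i * m) * (f ^+ p * k ^+ n * f ^+ (j * m)))%g.
  by rewrite /spread {1}jE expgnDr !mulgA.
rewrite /spread -mulgA.
have h1 := orbit_product_mull isom o (f ^+ (i * m))%g (k ^+ n * f ^+ (i * m))%g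
  (f ^+ p * k ^+ n * f ^+ (j * m))%g.
have h2 := orbit_product_mulr isom o (k ^+ n * f ^+ (i * m))%g
  (f ^+ p * k ^+ n)%g (f ^+ (j * m))%g.
have h3 := orbit_product_mulr isom o (f ^+ p * k ^+ n)%g (k ^+ n)%g (f ^+ (i * m))%g.
rewrite [X in X <= _]orbit_productC in h3.
have h4 := orbit_product_turn isom o (f ^+ p)%g (k ^+ n)%g.
rewrite -expVgn in h4.
have := fVk p n; have := fk p n.
have := orbit_four_point act fp o (f ^+ p * k ^+ n)%g (k ^+ n)%g (f ^+ p)%g.
have := orbit_four_point act fp o (k ^+ n)%g (f ^+ p * k ^+ n)%g (f ^+ p)%g.
rewrite (orbit_productC act o (k ^+ n)%g (f ^+ p)%g).
rewrite (orbit_productC act o (f ^+ p * k ^+ n)%g (f ^+ p)%g).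
rewrite (orbit_productC act o (k ^+ n)%g (f ^+ p * k ^+ n)%g).
by lra.
Qed.

(** The order of quantifiers matters: the separation [C] may depend on the number
    [K] of directions but not on the length [L], so that later constants built
    from [C] can be dwarfed by the lengths. *)
Lemma nonelementary_directions o (H : set G) : subgroup H ->
  nonelementary act H -> forall K : nat, exists2 C : R, 0 <= C &
  forall L : R, exists u : nat -> G,
    [/\ forall i, H (u i),
        forall i, (i < K)%N -> L <= N o (u i),
        forall i j, (i < K)%N -> (j < K)%N -> i != j -> P o (u i) (u j) <= C &
        forall i j, (i < K)%N -> (j < K)%N -> i != j ->
          P o (u i)^-1%g (u j)^-1%g <= C].
Proof.
move=> [H1 HM HV] [g [h [Hg Hh lg lh ind]]] K.
have HX x n : H x -> H (x ^+ n)%g.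
  by move=> Hx; elim: n => [|n IH]; rewrite ?expg0 // expgS; exact: HM.
have [a qf] := loxodromic_quasi_axial isom d0 o lg.
have [b qk] := loxodromic_quasi_axial isom d0 o lh.
set f := (g ^+ a)%g in qf; set k := (h ^+ b)%g in qk.
have fg : commute f g by exact/commute_sym/commuteX/commute_refl.
have kh : commute k h by exact/commute_sym/commuteX/commute_refl.
have fVg : commute f^-1%g g by exact/commute_sym/commuteV/commute_sym.
have kVh : commute k^-1%g h by exact/commute_sym/commuteV/commute_sym.
have qfV := quasi_axialV isom qf; have qkV := quasi_axialV isom qk.
have [C1 c1] := independent_product_bounded isom d0 fp qf qk fg kh ind.
have [C2 c2] := independent_product_bounded isom d0 fp qf qkV fg kVh ind.
have [C3 c3] := independent_product_bounded isom d0 fp qfV qk fVg kh ind.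
have [C4 c4] := independent_product_bounded isom d0 fp qfV qkV fVg kVh ind.
pose C := Num.max (Num.max C1 C2) (Num.max C3 C4).
have C0 : 0 <= C.
  apply: le_trans (orbit_product_ge0 act o (f ^+ 0)%g (k ^+ 0)%g) _.
  by apply: le_trans (c1 _ _) _; rewrite !le_max lexx.
have {}c1 p q : P o (f ^+ p)%g (k ^+ q)%g <= C.
  by apply: le_trans (c1 _ _) _; rewrite !le_max lexx ?orbT.
have {}c2 p q : P o (f ^+ p)%g (k^-1 ^+ q)%g <= C.
  by apply: le_trans (c2 _ _) _; rewrite !le_max lexx ?orbT.
have {}c3 p q : P o (f^-1 ^+ p)%g (k ^+ q)%g <= C.
  by apply: le_trans (c3 _ _) _; rewrite !le_max lexx ?orbT.
have {}c4 p q : P o (f^-1 ^+ p)%g (k^-1 ^+ q)%g <= C.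
  by apply: le_trans (c4 _ _) _; rewrite !le_max lexx ?orbT.
have [m far] := quasi_axial_unbounded isom d0 fp (2 * C + delta + 1) qf.
have {}far p : (m <= p)%N -> 2 * C + delta < N o (f ^+ p)%g.
  by move=> /far; lra.
have farV p : (m <= p)%N -> 2 * C + delta < N o (f^-1 ^+ p)%g.
  by move=> /far; rewrite expVgn displacementV.
pose D := (K * m)%:R * N o f.
have D0 : 0 <= D by rewrite mulr_ge0 ?ler0n // displacement_ge0.
have Df i : (i < K)%N -> N o (f ^+ (i * m))%g <= D.
  move=> iK; apply: le_trans (displacementX _ _ _) _.
  by rewrite ler_wpM2r ?displacement_ge0 // ler_nat leq_mul2r ltnW ?orbT.
have DfV i : (i < K)%N -> N o (f^-1 ^+ (i * m))%g <= D.
  by move=> /Df; rewrite expVgn displacementV.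
exists (3 * D + C + delta); first by move: d0; lra.
move=> L; have [n0 long] := quasi_axial_unbounded isom d0 fp (L + 2 * D) qk.
exists (spread f k m n0); split.
- by move=> i; apply: (HM _ _ (HM _ _ _ _) _); apply/HX/HX.
- move=> i /Df Di; have := long _ (leqnn n0).
  rewrite /spread; set x := (f ^+ (i * m))%g in Di *; set y := (k ^+ n0)%g.
  have := displacementM isom o (x^-1 * (x * y * x))%g x^-1%g.
  have := displacementM isom o x^-1%g (x * y * x)%g.
  by rewrite mulgA -(mulgA x y x) mulKg mulgK displacementV //; lra.
- move=> i j iK jK; rewrite neq_ltn => /orP[ij|ji].
    by apply: spread_separated c1 c3 far _ _ ij; exact: Df.
  by rewrite orbit_productC; apply: spread_separated c1 c3 far _ _ ji; exact: Df.
- have cVV p q : P o (f^-1^-1 ^+ p)%g (k^-1 ^+ q)%g <= C by rewrite invgK.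
  move=> i j iK jK; rewrite !spreadV neq_ltn => /orP[ij|ji].
    by apply: spread_separated c4 cVV farV _ _ ij; exact: DfV.
  by rewrite orbit_productC; apply: spread_separated c4 cVV farV _ _ ji; exact: DfV.
Qed.

(** Two applications of Gromov's inequality replace [a], [b] by points [a'], [b']
    far out in the same directions. *)
Lemma product_stable o a b a' b' C M :
  P o a b <= C -> M <= P o a a' -> M <= P o b b' -> C + 2 * delta < M ->
  P o a' b' <= C + 2 * delta.
Proof.
move=> ab aa bb CM.
have h1 := orbit_four_point act fp o a a' b.
have h2 := orbit_four_point act fp o a' b' b.
rewrite (orbit_productC act o b' b) in h2.
by move: d0; lra.
Qed.

(** [x y^-1 o] stays in the direction of [x o] when [x^-1 o] and [y^-1 o] are
    separated; the corrections [s], [t] cost a bounded amount. *)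
Lemma product_quotient_near o (s t x y : G) (C D : R) :
  N o s <= D -> N o t <= D -> P o x^-1%g y^-1%g <= C ->
  N o x - C - 2 * D <= P o (s * x)%g (s * (x * y^-1) * t)%g.
Proof.
move=> sD tD xyC.
have h1 := orbit_product_turn isom o x y^-1%g.
have h2 := orbit_product_mull_ge isom o s x (x * y^-1)%g.
have h3 := orbit_product_mulr isom o (s * x)%g (s * (x * y^-1) * t)%g t^-1%g.
rewrite mulgK displacementV // in h3.
by lra.
Qed.

(** The constants: translates of distinct directions by the same element have
    products at most [C0 + D], hence two directions cannot both be [C1]-close to a third; [C2]
    allows for replacing directions by orbit points of elements of [S]. *)
Theorem nonelementary_of_finite_cover (H S B : set G) :
  subgroup H -> nonelementary act H -> finite_set B ->
  (forall x, H x -> exists b1 y b2, [/\ B b1, S y, B b2 & x = (b1 * y * b2)%g]) ->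
  nonelementary act S.
Proof.
move=> subH neH /finite_seqP[bs BE] cover; have [_ HM HV] := subH.
have [g0 [_ [_ _ [ o _] _ _]]] := neH.
have [ss [ss1 ssB]] : exists ss : seq G,
    1%g \in ss /\ forall b, B b -> b \in ss /\ b^-1%g \in ss.
  exists (1 :: bs ++ map (fun b => b^-1) bs)%g; split; first exact: mem_head.
  rewrite BE /= => b bbs; rewrite !inE !mem_cat bbs !orbT; split=> //.
  by rewrite (map_f (fun b : G => b^-1%g) bbs) !orbT.
pose D : R := \sum_(s <- ss) N o s.
have ssD s : s \in ss -> N o s <= D.
  move=> sss; rewrite /D (big_rem s sss) /= lerDl.
  by apply: sumr_ge0 => t _; exact: displacement_ge0.
have D0 : 0 <= D by apply: sumr_ge0 => t _; exact: displacement_ge0.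
have [K Kbig] : exists K, (3 * size ss * size ss < K)%N by eexists; exact: ltnSn.
have [C0 C00 dirs] := nonelementary_directions o subH neH K.
pose C1 := C0 + D + delta + 1.
pose C2 := C1 + 2 * delta.
have [u [Hu uL usep uVsep]] := dirs (C0 + 2 * D + 2 * C2 + 3 * delta + 1).
pose bad (t : nat * (G * G)) (j : nat) :=
  C1 < P o (t.2.1 * u t.1)%g (t.2.2 * u j)%g.
(* Each triple (previous index, two corrections) excludes at most one new
   index, and three previous indices are the most that occur. *)
have pick (prev : seq nat) : (size prev <= 3)%N ->
    exists2 j, (j < K)%N & forall i, i \in prev ->
      forall s t, s \in ss -> t \in ss -> P o (s * u i)%g (t * u j)%g <= C1.
  move=> size3.
  pose ts := [seq (i, st) | i <- prev, st <- [seq (s, t) | s <- ss, t <- ss]].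
  have [||t x y|j] := @avoid_unique_bad _ _ ts (iota 0 K) bad.
  - exact: iota_uniq.
  - rewrite size_iota (leq_ltn_trans _ Kbig) // /ts.
    by rewrite !size_allpairs mulnA !leq_mul2r size3 !orbT.
  - case/allpairsP => -[i st] [/= _ /allpairsP[[a b] [/= _ bss ->]] ->].
    rewrite !mem_iota !add0n /= => xK yK; rewrite /bad /= => badx bady.
    apply/eqP/negPn/negP => xy.
    have := usep _ _ xK yK xy; have := ssD _ bss.
    have := orbit_product_mull isom o b (u x) (u y).
    have := orbit_four_point act fp o (b * u x)%g (a * u i)%g (b * u y)%g.
    rewrite (orbit_productC act o (b * u x)%g (a * u i)%g).
    by move: badx bady; rewrite /C1; lra.
  rewrite mem_iota add0n /= => jK good; exists j => // i iprev a b ass bss.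
  rewrite leNgt; apply/negP; apply: (good (i, (a, b))).
  apply/allpairsP; exists (i, (a, b)); split => //=.
  by apply/allpairsP; exists (a, b).
(* The correction terms produced by the cover are only known here, after the
   indices have been fixed. *)
have quotient i j : (i < K)%N -> (j < K)%N ->
    (forall s t, s \in ss -> t \in ss -> P o (s * u i)%g (t * u j)%g <= C1) ->
    exists g s t, [/\ S g, s \in ss, t \in ss,
      2 * C2 + 3 * delta < P o (s * u i)%g g &
      2 * C2 + 3 * delta < P o (t * u j)%g g^-1%g].
  move=> iK jK sep.
  (* [sep] with trivial corrections fails for [i = j], as [P u u = N u] is large. *)
  have ij : i != j.
    apply/eqP => ij; have := sep _ _ ss1 ss1.
    rewrite ij orbit_product_self mul1g; have := uL _ jK.
    by move: d0; rewrite /C2 /C1; lra.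
  have [b1 [g [b2 [Bb1 Sg Bb2 wE]]]] := cover _ (HM _ _ (Hu i) (HV _ (Hu j))).
  have [b1s b1Vs] := ssB _ Bb1; have [b2s b2Vs] := ssB _ Bb2.
  exists g, b1^-1%g, b2; split => //.
    have -> : g = (b1^-1 * (u i * (u j)^-1) * b2^-1)%g.
      by rewrite wE !mulgA mulVg mul1g mulgK.
    have := product_quotient_near (ssD _ b1Vs) (ssD _ b2Vs) (uVsep _ _ iK jK ij).
    by have := uL _ iK; lra.
  have -> : g^-1%g = (b2 * (u j * (u i)^-1) * b1)%g.
    have -> : (u j * (u i)^-1 = (u i * (u j)^-1)^-1)%g by rewrite invgM invgK.
    by rewrite wE !invgM !mulgA mulgV mul1g mulgVK.
  rewrite eq_sym in ij.
  have := product_quotient_near (ssD _ b2s) (ssD _ b1s) (uVsep _ _ jK iK ij).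
  by have := uL _ jK; lra.
have [i1 i1K _] := pick [::] isT.
have [i2 i2K sep2] := pick [:: i1] isT.
have [i3 i3K sep3] := pick [:: i1; i2] isT.
have [i4 i4K sep4] := pick [:: i1; i2; i3] isT.
have [g [s1 [s2 [Sg s1s s2s near1 near2]]]] :=
  quotient i1 i2 i1K i2K (sep2 _ (mem_head _ _)).
have [h [s3 [s4 [Sh s3s s4s near3 near4]]]] :=
  quotient i3 i4 i3K i4K (sep4 i3 ltac:(by rewrite !inE eqxx !orbT)).
have C12 : C1 + 2 * delta < 2 * C2 + 3 * delta by move: d0; rewrite /C2 /C1; lra.
have stable a b a' b' : P o a b <= C1 -> 2 * C2 + 3 * delta < P o a a' ->
    2 * C2 + 3 * delta < P o b b' -> P o a' b' <= C2.
  by move=> ab /ltW aa /ltW bb; exact: product_stable ab aa bb C12.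
have long a a' : 2 * C2 + 3 * delta < P o a a' -> 2 * C2 + 3 * delta < N o a'.
  by move=> /lt_le_trans; apply; exact: orbit_product_ler.
have gV : P o g g^-1%g <= C2.
  by apply: stable near1 near2; exact: sep2 (mem_head _ _) _ _ _ _.
have hV : P o h h^-1%g <= C2.
  by apply: stable near3 near4; apply: sep4; rewrite // !inE eqxx !orbT.
exists g, h; split => //.
- apply: (quasi_axial_loxodromic isom d0 fp (o := o)).
  by rewrite /quasi_axial orbit_productC; have := long _ _ near1; lra.
- apply: (quasi_axial_loxodromic isom d0 fp (o := o)).
  by rewrite /quasi_axial orbit_productC; have := long _ _ near3; lra.
apply: (separated_independent isom fp (long _ _ near1) (long _ _ near3)).
- by apply: stable near1 near3; apply: sep3; rewrite // !inE eqxx.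
- by apply: stable near1 near4; apply: sep4; rewrite // !inE eqxx.
- by apply: stable near2 near3; apply: sep3; rewrite // !inE eqxx ?orbT.
- by apply: stable near2 near4; apply: sep4; rewrite // !inE eqxx ?orbT.
Qed.


End Directions.

(** * The loop semigroups *)

Theorem proposition6p3 (R : realType) (G : groupType) (X : metricType R)
    (act : G -> X -> X) (Gam : graph_structure G) (lam : R) (H : set G) :
  countable [set: G] ->
  hyperbolic_space X ->
  separable_space X ->
  isometric_action act ->
  almost_semisimple Gam lam ->
  subgroup H ->
  nonelementary act H ->
  thick_relative Gam lam H ->
  forall v : gvertex Gam,
    maximal_vertex lam v -> nonelementary act (loop_semigroup v).
Proof.
move=> _ hypX _ isom _ subH neH thick v vmax.
have [delta d0 fp] := hyperbolic_four_point hypX.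
have [B finB cover] := thick v vmax.
exact: (nonelementary_of_finite_cover isom d0 fp subH neH finB cover).
Qed.
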